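(* Let $k$ be a field, $n\ge 1$ an integer, $X=\{x_0,\dots,x_n\}$ and $Y=\{y_0,\dots,y_n\}$. Let $R$ be a local $k$-subalgebra of $k\langle\langle X\rangle\rangle$ containing $k\langle X\rangle$ and invariant under the maps $\delta_0,\dots,\delta_n$, let $S=R\langle Y;\tau,\delta\rangle$, let $e=1-\sum_{i=0}^n y_ix_i\in S$, and let $I=SeS$. Let $f:R\to R^{n+1}$ be the right $R$-module homomorphism given by left multiplication by the column $(x_0,\dots,x_n)^T$. Then the universal localization $R_f$ is a purely infinite simple regular ring, and every finitely generated projective $R_f$-module is free. Moreover, $R_f\cong S/I$, and $S$ is regular.
   Context: All rings are unital; ''regular'' means von Neumann regular. $k\langle X\rangle$ is the free $k$-algebra and $k\langle\langle X\rangle\rangle$ the algebra of noncommutative formal power series $\sum_{w\in X^*}\lambda_w w$ ($\lambda_w\in k$), where $X^*$ is the free monoid on $X$. Let $\tau:k\langle\langle X\rangle\rangle\to k\langle\langle X\rangle\rangle$ be the $k$-algebra homomorphism taking a series to its constant term, and define $k$-linear maps $\delta_i$ by $\delta_i\bigl(\sum_w\lambda_w w\bigr)=\sum_w\lambda_{wx_i}w$. They satisfy $\delta_i(rs)=\delta_i(r)\tau(s)+r\delta_i(s)$. $R\langle Y;\tau,\delta\rangle$ is the ring containing $R$ as a subring and the free monoid $Y^*$ on $Y$ as a multiplicative submonoid, which is free as a right $R$-module (under ring multiplication) with basis $Y^*$, and in which $ry_i=y_i\tau(r)+\delta_i(r)$ for all $i$ and all $r\in R$ (such a ring exists and is unique;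 in it $x_iy_j=\delta_{ij}$, the Kronecker delta). The universal localization $R\to R_f$ is the universal ring homomorphism from $R$ such that $f\otimes_R 1_{R_f}$ becomes invertible. An idempotent $e$ in a ring $A$ is infinite if $e=g+h$ with $g,h$ orthogonal idempotents, $h\neq0$ and $eA\cong gA$; a simple ring is purely infinite if each of its nonzero right ideals contains an infinite idempotent. *)

(* Defs.v *)
From HB Require Import structures.
From mathcomp Require Import all_boot all_order all_algebra.
From mathcomp Require Import boolp classical_sets functions cardinality.

Set Implicit Arguments.
Unset Strict Implicit.
Unset Printing Implicit Defensive.

Import GRing.Theory.
Local Open Scope classical_set_scope.
Local Open Scope ring_scope.
Local Open Scope quotient_scope.

(* The type is an alias of [seq X -> k]: it inherits the pointwise k-module
   structure of functions, but carries the convolution product instead of the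
   pointwise one. *)
Definition ncseries (k : fieldType) (X : Type) : Type := seq X -> k.

HB.instance Definition _ (k : fieldType) (X : Type) :=
  GRing.Lmodule.copy (ncseries k X) (seq X -> k^o).

Section NCSeries.
Context {k : fieldType} {X : Type}.
Implicit Types (r s t : ncseries k X) (w : seq X) (x : X).

Definition ncmul s t : ncseries k X :=
  fun w => \sum_(i < (size w).+1) s (take i w) * t (drop i w).

Definition ncone : ncseries k X := fun w => (nilp w)%:R.

Let lder x s : ncseries k X := fun w => s (x :: w).

Let ncmul_cons s t x w :
  ncmul s t (x :: w) = s [::] * t (x :: w) + ncmul (lder x s) t w.
Proof. by rewrite /ncmul big_ord_recl. Qed.

Let ncmul_nil s t : ncmul s t [::] = s [::] * t [::].
Proof. by rewrite /ncmul big_ord1. Qed.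

Let ncmulDl : left_distributive ncmul +%R.
Proof.
move=> r s t; apply/funext => w; rewrite /ncmul [RHS]/GRing.add /= -big_split /=.
by apply: eq_bigr => i _; rewrite -mulrDl.
Qed.

Let ncmulDr : right_distributive ncmul +%R.
Proof.
move=> r s t; apply/funext => w; rewrite /ncmul [RHS]/GRing.add /= -big_split /=.
by apply: eq_bigr => i _; rewrite -mulrDr.
Qed.

Let ncmulZl (a : k) s t : a *: ncmul s t = ncmul (a *: s) t.
Proof.
apply/funext => w; rewrite /ncmul [LHS]/GRing.scale /= [LHS]mulr_sumr.
by apply: eq_bigr => i _; rewrite [in LHS]mulrA.
Qed.

Let ncmulZr (a : k) s t : a *: ncmul s t = ncmul s (a *: t).
Proof.
apply/funext => w; rewrite /ncmul [LHS]/GRing.scale /= [LHS]mulr_sumr.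
by apply: eq_bigr => i _; rewrite [in LHS]mulrCA.
Qed.

Let ncmulA : associative ncmul.
Proof.
move=> r s t; apply/funext => w.
elim: w r s t => [|x w IHw] r s t; first by rewrite !ncmul_nil mulrA.
rewrite ncmul_cons IHw !ncmul_cons ncmul_nil.
have -> : lder x (ncmul r s) = r [::] *: lder x s + ncmul (lder x r) s.
  by apply/funext => v; rewrite /lder ncmul_cons.
by rewrite ncmulDl -ncmulZl [X in _ = _ + X]/GRing.add /= mulrDr !mulrA addrA.
Qed.

Let ncmul1l : left_id ncone ncmul.
Proof.
move=> s; apply/funext => w; rewrite /ncmul big_ord_recl take0 drop0 mul1r.
rewrite big1 ?addr0// => i _; rewrite /ncone.
by case: w i => [[]//|x w] i /=; rewrite mul0r.
Qed.

Let ncmul1r : right_id ncone ncmul.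
Proof.
move=> s; apply/funext => w; rewrite /ncmul big_ord_recr /= take_size drop_size.
rewrite mulr1 big1 ?add0r// => i _; rewrite /ncone.
by rewrite /nilp size_drop subn_eq0 leqNgt ltn_ord mulr0.
Qed.

Let ncone_neq0 : ncone != 0.
Proof. by apply/eqP => /(congr1 (@^~ [::])) /eqP; rewrite oner_eq0. Qed.

HB.instance Definition _ := GRing.Zmodule_isNzRing.Build (ncseries k X)
  ncmulA ncmul1l ncmul1r ncmulDl ncmulDr ncone_neq0.
HB.instance Definition _ :=
  GRing.Lmodule_isLalgebra.Build k (ncseries k X) ncmulZl.
HB.instance Definition _ :=
  GRing.Lalgebra_isAlgebra.Build k (ncseries k X) ncmulZr.

Definition nctau s : ncseries k X := (s [::])%:A.

Definition ncdelta x s : ncseries k X := fun w => s (rcons w x).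

Lemma ncdeltaM x r s :
  ncdelta x (r * s) = ncdelta x r * nctau s + r * ncdelta x s.
Proof.
rewrite /nctau -scalerAr mulr1 addrC; apply/funext => w.
rewrite /ncdelta [LHS]/GRing.mul /= /ncmul size_rcons big_ord_recr /=.
rewrite -[in take _.+1 _](size_rcons w x) take_size.
rewrite -[in drop _.+1 _](size_rcons w x) drop_size [X in _ + X = _]mulrC.
congr (_ + _); apply: eq_bigr => i _.
by rewrite -cats1 takel_cat -?drop_rcons ?cats1// -ltnS ltn_ord.
Qed.

End NCSeries.

Definition ncvar {k : fieldType} {X : eqType} (x : X) : ncseries k X :=
  fun w => (w == [:: x])%:R.

Section SubAlgebra.
Context {k : fieldType} {A : algType k} (R : subalgClosed A).

Record subalg := SubAlg { subalg_val : A; subalg_valP : subalg_val \in R }.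

HB.instance Definition _ := [isSub for subalg_val].
HB.instance Definition _ := [Choice of subalg by <:].
HB.instance Definition _ := [SubChoice_isSubAlgebra of subalg by <:].

End SubAlgebra.

Section SubSeries.
Context {k : fieldType} {X : eqType} (R : subalgClosed (ncseries k X)).

(* The free algebra consists of the series of finite support. *)
Definition contains_free_algebra : Prop :=
  forall s : ncseries k X, finite_set [set w | s w != 0] -> s \in R.

Definition delta_invariant : Prop :=
  forall (x : X) (s : ncseries k X), s \in R -> ncdelta x s \in R.

Lemma ncvar_in (hX : contains_free_algebra) x : ncvar x \in R.
Proof.
apply: hX; apply: (sub_finite_set _ (finite_set1 [:: x])) => w /=.
by rewrite /ncvar; case: (w =P [:: x]) => //= _; rewrite mulr0n eqxx.
Qed.

Lemma nctau_in (s : ncseries k X) : nctau s \in R.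
Proof. by rewrite rpredZ ?rpred1. Qed.

Definition sub_var (hX : contains_free_algebra) (x : X) : subalg R :=
  SubAlg (ncvar_in hX x).

Definition sub_tau (r : subalg R) : subalg R := SubAlg (nctau_in (val r)).

Definition sub_delta (hd : delta_invariant) (x : X) (r : subalg R) : subalg R :=
  SubAlg (hd x (val r) (valP r)).

End SubSeries.

Section RingNotions.
Context {A : pzRingType}.
Implicit Types (a b e g h : A) (J K : set A).

Definition right_ideal J : Prop :=
  [/\ J 0, (forall a b, J a -> J b -> J (a + b))
    & (forall a b, J a -> J (a * b))].

Definition twosided_ideal J : Prop :=
  right_ideal J /\ (forall a b, J b -> J (a * b)).

Definition is_unit a : Prop := exists b, a * b = 1 /\ b * a = 1.

(* Since an ideal contains 0, this forces A to be nonzero. *)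
Definition local_ring : Prop := twosided_ideal [set a | ~ is_unit a].

Definition regular_ring : Prop := forall a, exists b, a * b * a = a.

Definition simple_ring : Prop :=
  (1 : A) != 0 /\ (forall J, twosided_ideal J -> J = [set 0] \/ J = setT).

Definition idempotent e : Prop := e * e = e.

Definition principal_right_ideal e : set A := [set e * a | a in setT].

Definition right_ideal_iso J K : Prop :=
  exists f : A -> A,
    [/\ set_bij J K f,
        (forall a b, J a -> J b -> f (a + b) = f a + f b)
      & (forall a b, J a -> f (a * b) = f a * b)].

Definition infinite_idempotent e : Prop :=
  idempotent e /\
  exists g h, [/\ idempotent g /\ idempotent h, g * h = 0 /\ h * g = 0,
    e = g + h, h <> 0
    & right_ideal_iso (principal_right_ideal e) (principal_right_ideal g)].

Definition purely_infinite : Prop :=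
  forall J, right_ideal J -> J <> [set 0] ->
    exists e, J e /\ infinite_idempotent e.

End RingNotions.
Arguments local_ring : clear implicits.
Arguments regular_ring : clear implicits.
Arguments simple_ring : clear implicits.
Arguments purely_infinite : clear implicits.

Section ModuleNotions.
Context {A : pzRingType} (M : lmodType A).

Definition fg_module : Prop :=
  exists (m : nat) (g : 'I_m -> M),
    forall v, exists c : 'I_m -> A, v = \sum_(i < m) c i *: g i.

Definition projective_module : Prop :=
  forall (N P : lmodType A) (p : {linear N -> P}) (h : {linear M -> P}),
    (forall z : P, exists u : N, p u = z) ->
    exists l : {linear M -> N}, forall v, p (l v) = h v.

Definition is_basis (B : set M) : Prop :=
  (forall v, exists (s : seq M) (c : M -> A),
     {in s, forall b, B b} /\ v = \sum_(b <- s) c b *: b) /\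
  (forall (s : seq M) (c : M -> A), uniq s -> {in s, forall b, B b} ->
     \sum_(b <- s) c b *: b = 0 -> {in s, forall b, c b = 0}).

Definition free_module : Prop := exists B : set M, is_basis B.

End ModuleNotions.

(* Right A-modules are left modules over the converse ring A^c. *)
Definition fg_projective_right_modules_free (A : pzRingType) : Prop :=
  forall M : lmodType A^c,
    fg_module M -> projective_module M -> free_module M.

Section PrincipalQuotient.
Context {S : pzRingType} (e : S).

Definition ideal_gen : {pred S} :=
  fun x => `[< exists s : seq (S * S), x = \sum_(ab <- s) ab.1 * e * ab.2 >].

Let ideal_genP x : reflect
  (exists s : seq (S * S), x = \sum_(ab <- s) ab.1 * e * ab.2) (x \in ideal_gen).
Proof. exact: asboolP. Qed.

Let ideal_gen_zmod : zmod_closed ideal_gen.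
Proof.
split; first by apply/ideal_genP; exists [::]; rewrite big_nil.
move=> _ _ /ideal_genP[s ->] /ideal_genP[t ->]; apply/ideal_genP.
exists (s ++ [seq (- ab.1, ab.2) | ab <- t]).
rewrite big_cat big_map /= -sumrN; congr (_ + _).
by apply: eq_bigr => ab _; rewrite !mulNr.
Qed.

HB.instance Definition _ := GRing.isZmodClosed.Build S ideal_gen ideal_gen_zmod.

Lemma ideal_genMl a x : x \in ideal_gen -> a * x \in ideal_gen.
Proof.
move=> /ideal_genP[s ->]; apply/ideal_genP.
exists [seq (a * ab.1, ab.2) | ab <- s].
by rewrite big_map mulr_sumr; apply: eq_bigr => ab _; rewrite /= !mulrA.
Qed.

Lemma ideal_genMr a x : x \in ideal_gen -> x * a \in ideal_gen.
Proof.
move=> /ideal_genP[s ->]; apply/ideal_genP.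
exists [seq (ab.1, ab.2 * a) | ab <- s].
by rewrite big_map mulr_suml; apply: eq_bigr => ab _; rewrite /= !mulrA.
Qed.

Definition quot_ring : Type := Quotient.quot ideal_gen.

HB.instance Definition _ := ZmodQuotient.on quot_ring.

Definition quot_pi (x : S) : quot_ring := \pi_quot_ring x.

Let quot_piK (x : quot_ring) : quot_pi (repr x) = x.
Proof. exact: reprK. Qed.

Lemma quot_pi_eq x y : quot_pi x = quot_pi y <-> x - y \in ideal_gen.
Proof. by rewrite /quot_pi Quotient.idealrBE; split => /eqP. Qed.

Definition quot_one : quot_ring := quot_pi 1.
Definition quot_mul (x y : quot_ring) : quot_ring := quot_pi (repr x * repr y).

Let quot_piM x y : quot_pi (x * y) = quot_mul (quot_pi x) (quot_pi y).
Proof.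
set x' := repr (quot_pi x); set y' := repr (quot_pi y).
have hx : x - x' \in ideal_gen by apply/quot_pi_eq; rewrite quot_piK.
have hy : y - y' \in ideal_gen by apply/quot_pi_eq; rewrite quot_piK.
apply/quot_pi_eq; rewrite -/x' -/y'.
have -> : x * y - x' * y' = (x - x') * y + x' * (y - y').
  by rewrite mulrBl mulrBr addrA subrK.
by apply: rpredD; [exact: ideal_genMr | exact: ideal_genMl].
Qed.

Let quot_piD x y : quot_pi (x + y) = quot_pi x + quot_pi y.
Proof. exact: raddfD. Qed.

Let quot_mulA : associative quot_mul.
Proof.
move=> x y z; rewrite -(quot_piK x) -(quot_piK y) -(quot_piK z).
by rewrite -!quot_piM mulrA.
Qed.

Let quot_mul1l : left_id quot_one quot_mul.
Proof. by move=> x; rewrite -(quot_piK x) -quot_piM mul1r. Qed.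

Let quot_mul1r : right_id quot_one quot_mul.
Proof. by move=> x; rewrite -(quot_piK x) -quot_piM mulr1. Qed.

Let quot_mulDl : left_distributive quot_mul +%R.
Proof.
move=> x y z; rewrite -(quot_piK x) -(quot_piK y) -(quot_piK z).
by rewrite -quot_piD -!quot_piM -quot_piD mulrDl.
Qed.

Let quot_mulDr : right_distributive quot_mul +%R.
Proof.
move=> x y z; rewrite -(quot_piK x) -(quot_piK y) -(quot_piK z).
by rewrite -quot_piD -!quot_piM -quot_piD mulrDr.
Qed.

HB.instance Definition _ := GRing.Zmodule_isPzRing.Build quot_ring
  quot_mulA quot_mul1l quot_mul1r quot_mulDl quot_mulDr.

Lemma quot_pi_zmod_morphism : zmod_morphism quot_pi.
Proof. exact: raddfB. Qed.

Lemma quot_pi_monoid_morphism : monoid_morphism quot_pi.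
Proof. by split=> // x y; exact: quot_piM. Qed.

HB.instance Definition _ :=
  GRing.isZmodMorphism.Build S quot_ring quot_pi quot_pi_zmod_morphism.
HB.instance Definition _ :=
  GRing.isMonoidMorphism.Build S quot_ring quot_pi quot_pi_monoid_morphism.

End PrincipalQuotient.

Definition word_prod {S : pzRingType} {X : Type} (y : X -> S) (w : seq X) : S :=
  \prod_(i <- w) y i.

(* [S], with [iota] the inclusion of [R] and [y] the family of the y_i, is the
   ring R<Y; tau, delta>. The basis condition for the family of all words
   entails that Y* embeds in S. *)
Definition is_skew_extension {R S : pzRingType} {X : eqType}
    (tau : R -> R) (delta : X -> R -> R)
    (iota : {rmorphism R -> S}) (y : X -> S) : Prop :=
  [/\ injective iota,
      (forall i r, iota r * y i = y i * iota (tau r) + iota (delta i r)),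
      (forall z : S, exists (s : seq (seq X)) (c : seq X -> R),
         z = \sum_(w <- s) word_prod y w * iota (c w))
    & (forall (s : seq (seq X)) (c : seq X -> R), uniq s ->
         \sum_(w <- s) word_prod y w * iota (c w) = 0 ->
         {in s, forall w, c w = 0})].

(* The homomorphism R^q -> R^p of right modules (of column vectors) given by
   left multiplication by F becomes invertible after base change along phi. *)
Definition inverts {R T : pzRingType} {p q : nat} (F : 'M[R]_(p, q))
    (phi : {rmorphism R -> T}) : Prop :=
  bijective (fun v : 'cV[T]_q => map_mx phi F *m v).

Definition is_universal_localization {R L : pzRingType} {p q : nat}
    (F : 'M[R]_(p, q)) (phi : {rmorphism R -> L}) : Prop :=
  inverts F phi /\
  (forall (T : pzRingType) (psi : {rmorphism R -> T}), inverts F psi ->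
     (exists h : {rmorphism L -> T}, forall r, h (phi r) = psi r) /\
     (forall h1 h2 : {rmorphism L -> T},
        (forall r, h1 (phi r) = psi r) -> (forall r, h2 (phi r) = psi r) ->
        h1 =1 h2)).

(* Main.v *)
Require Import Defs.
From HB Require Import structures.
From mathcomp Require Import all_boot all_order all_algebra.
From mathcomp Require Import boolp classical_sets functions cardinality.

Set Implicit Arguments.
Unset Strict Implicit.
Unset Printing Implicit Defensive.
Import GRing.Theory.
Local Open Scope ring_scope.

(** The defining rule [r y_i = y_i tau(r) + delta_i(r)] turns [x_i y_j] into the
    Kronecker delta, and then [e = 1 - \sum_i y_i x_i] is an idempotent with
    [x_i e = 0 = e y_i].  Since every series is
    [r = tau(r) + \sum_i delta_i(r) x_i], [r e = tau(r) e] for every [r]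
    in [R].

    Substituting [1 = e + \sum_i y_i x_i] into itself [m] times (lemma
    [resolution]) writes an element [z] as [\sum_w y_w (x_w z)] over the words of
    length [m], up to terms in the ideal [I] generated by [e]; for large [m] all
    the [x_w z] lie in [R] ([span_xwords]).  So modulo [I] an element is just a
    column [c] over [R], and it can be diagonalized by Gaussian elimination
    ([diagonalizable_sum]): if [v] is the reversal of a shortest word
    occurring in the column, then right multiplication by [y_v] only strips
    this word from the entries, so it yields another column over [R] one of
    whose entries has nonzero constant term, hence is a unit because [R] is
    local ([diagonalizable_span]).

    Consequently every [z] in [S/I] has the form [\sum_i (z a_i)(l_i z)] with
    [l_i z a_j] the Kronecker delta.  This makes [z] regular, makes the right
    ideal [z (S/I)] free with basis the [z a_i], and gives [l z a = 1] for some
    [l], [a] when [z] is nonzero.  The last property, together with the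
    isometries [y_i] for two distinct letters, yields simplicity and pure
    infiniteness; a finitely generated projective module embeds in [S/I] as a
    principal right ideal by means of the same isometries, so it is free.

    The elements of [I] are the finite sums [\sum_w y_w e r_w], where only the
    coefficients of the [r_w], elements of the field [k], matter.  The same
    elimination with [e] in place of [1] shows that they are regular
    ([diagonalizable_ideal]), and regularity passes from [I] and [S/I] to [S].

    As for the localization, inverting the column of the [x_i] means adjoining a
    row [y] inverse to it, and such a row satisfies the skew commutation rule
    automatically ([inverse_row_skew]).  Hence the [y_w r] span a subring of
    [R_f], which is everything by universality ([localization_generated]).  The
    structure theory above therefore applies to [R_f] itself: it is simple, and
    so the canonical map [R_f -> S/I] is injective; it is onto because its image
    contains [R] and the [y_i]. *)

(** * Diagonalizing elements of a ring *)

Section Diagonalization.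
Context {T : pzRingType}.
Implicit Types (g z : T).

(** The right ideal [z T] is the direct sum of the ideals [z a_i T], each
    isomorphic to [g T], and the [l_i] are the coordinate maps.  With [g = 1]
    this makes [z T] a free module; for any [g] it makes [z] regular. *)
Definition diagonalizable g z : Prop :=
  exists (m : nat) (a l : 'I_m -> T),
    (forall i j, l i * z * a j = (i == j)%:R * g) /\
    z = \sum_(i < m) z * a i * l i * z.

Lemma diagonalizable_regular g z :
  diagonalizable g z -> exists b, z * b * z = z.
Proof.
move=> [m [a [l [_ zE]]]]; exists (\sum_(i < m) a i * l i).
rewrite mulr_sumr mulr_suml [RHS]zE.
by apply: eq_bigr => i _; rewrite !mulrA.
Qed.

Lemma diagonalizable1_unit z :
  diagonalizable 1 z -> z != 0 -> exists a b, a * z * b = 1.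
Proof.
move=> [[|m] [a [l [lza zE]]]] z0; first by rewrite zE big_ord0 eqxx in z0.
by exists (l ord0), (a ord0); rewrite lza eqxx mulr1.
Qed.

Lemma diagonalizable0 g : diagonalizable g 0.
Proof.
exists 0%N, (fun=> 0), (fun=> 0); split; last by rewrite big_ord0.
by case.
Qed.

(** Here [b = q p] satisfies [b z b = b], so [z b] is an idempotent which splits
    off the summand [z b T], a copy of [g T], from [z T]. *)
Lemma diagonalizable_step g z q p :
    q * g = q -> g * p = p -> p * z * q = g ->
  diagonalizable g (z - z * (q * p) * z) -> diagonalizable g z.
Proof.
move=> qg gp pzq; have [b bE] : exists b, b = q * p by exists (q * p).
rewrite -bE; set z' := z - z * b * z.
move=> [m [a [l [lza zE]]]].
have pz' : p * z' = 0.
  by rewrite /z' bE mulrBr !mulrA pzq gp subrr.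
have z'q : z' * q = 0.
  by rewrite /z' bE mulrBl !mulrA -!(mulrA _ p) -(mulrA _ (p * z)) pzq -!mulrA
    qg subrr.
have z1 : z * (1 - b * z) = z' by rewrite mulrBr mulr1 mulrA.
have z2 : (1 - z * b) * z = z' by rewrite mulrBl mul1r.
have z3 : z' * (1 - b * z) = z' by rewrite mulrBr mulr1 bE !mulrA z'q !mul0r subr0.
exists m.+1, (fun i => oapp (fun i => (1 - b * z) * a i) q (unlift ord0 i)),
  (fun i => oapp (fun i => l i * (1 - z * b)) p (unlift ord0 i)); split.
  move=> i j; case: (unliftP ord0 i) => [i'|] ->; case: (unliftP ord0 j) => [j'|] -> /=.
  - rewrite -(mulrA (l i')) z2 !mulrA -(mulrA (l i')) z3 lza.
    by rewrite (inj_eq lift_inj).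
  - by rewrite -(mulrA (l i')) z2 -mulrA z'q mulr0 mul0r.
  - by rewrite mulrA -(mulrA p z) z1 pz' !mul0r.
  - by rewrite pzq mul1r.
rewrite big_ord_recl unlift_none /=.
under eq_bigr => i _ do rewrite liftK /= !mulrA z1 -(mulrA _ _ z) z2.
by rewrite -zE /z' bE !mulrA addrC subrK.
Qed.

Context {R : pzRingType} {J : eqType} (phi : {rmorphism R -> T}).

(** Gaussian elimination on the column [c] over [R], transported into [T] by the
    row [u].  A pivot is an entry [c j] which right multiplication by some [q]
    turns into [1] while it keeps the whole column over [R]; subtracting a
    rank-one term then clears this entry. *)
Lemma diagonalizable_sum g (u p : J -> T) :
    g * g = g ->
    (forall (A : seq J) (c : J -> R), (exists2 i, i \in A & c i != 0) ->
      exists j q (d : J -> R), [/\ j \in A, d j = 1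
        & forall i, i \in A -> g * phi (c i) * q * g = g * phi (d i)]) ->
  forall A, uniq A ->
    (forall i j, i \in A -> j \in A -> p i * u j * g = (i == j)%:R * g) ->
  forall c, diagonalizable g (\sum_(w <- A) u w * g * phi (c w)).
Proof.
move=> gg pivot A; have [m] := ubnP (size A).
elim: m A => // m IH A /ltnSE sA uA pu c.
have [nz|c0] := pselect (exists2 i, i \in A & c i != 0); last first.
  rewrite big_seq big1 => [|i iA]; first exact: diagonalizable0.
  have [->|ci] := eqVneq (c i) 0; first by rewrite rmorph0 mulr0.
  by case: c0; exists i.
have [j [q [d [jA dj gd]]]] := pivot A c nz.
set z := \sum_(w <- A) _.
have pz i : i \in A -> p i * z = g * phi (c i).
  move=> iA; rewrite /z mulr_sumr (big_rem i)//= big_seq big1 ?addr0.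
    by rewrite !mulrA pu// eqxx mul1r.
  move=> w; rewrite mem_rem_uniq// inE => /andP[wi wA].
  by rewrite !mulrA pu// eq_sym (negbTE wi) !mul0r.
apply: (@diagonalizable_step g z (q * g) (g * p j)); rewrite ?mulrA ?gg//.
- by rewrite -mulrA gg.
- by rewrite -(mulrA g) pz// mulrA gg gd// dj rmorph1 mulr1.
suff -> : z - z * q * g * g * p j * z
    = \sum_(w <- rem j A) u w * g * phi (c w - d w * c j).
  apply: IH; first by rewrite size_rem// prednK//; case: (A) jA.
    exact: rem_uniq.
  by move=> i i' /mem_rem iA /mem_rem i'A; exact: pu.
rewrite -(mulrA _ (p j)) pz// -(mulrA _ g g) gg [in z * q]/z !mulr_suml -sumrB.
rewrite (big_rem j)//=.
have E w : w \in A -> u w * g * phi (c w) * q * g * (g * phi (c j)) =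
    u w * g * phi (d w * c j).
  move=> wA; transitivity (u w * (g * phi (c w) * q * g) * phi (c j)).
    by rewrite !mulrA -(mulrA _ g g) gg.
  by rewrite gd// rmorphM !mulrA.
rewrite E// dj mul1r subrr add0r big_seq [RHS]big_seq.
by apply: eq_bigr => w /mem_rem wA; rewrite E// rmorphB mulrBr.
Qed.
End Diagonalization.

(** * Ring-theoretic consequences *)

Section Consequences.
Context {T : pzRingType}.

Lemma unit_factor_simple :
    (1 : T) != 0 -> (forall z : T, z != 0 -> exists a b, a * z * b = 1) ->
  simple_ring T.
Proof.
move=> T1 fact; split=> // J [[J0 JD JM] JMl].
have [Jz|/existsNP[z /not_implyP[Jz /eqP z0]]] :=
    pselect (forall z, J z -> z = 0).
  by left; apply/seteqP; split=> [z /Jz//|_ ->].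
right; have [a [b ab]] := fact z z0; apply/seteqP; split=> // c _.
by rewrite -[c]mul1r -ab; apply/JM/JM/JMl.
Qed.

Lemma simple_ring_hom_injective (T' : pzRingType) (h : {rmorphism T -> T'}) :
  simple_ring T -> (1 : T') != 0 -> injective h.
Proof.
move=> [_ simT] T'1; pose K : set T := [set z | h z = 0]%classic.
have K2 : twosided_ideal K.
  split; first split=> /=; first exact: rmorph0.
  - by move=> a b ha hb; rewrite /K /= rmorphD ha hb addr0.
  - by move=> a b ha; rewrite /K /= rmorphM ha mul0r.
  - by move=> a b hb; rewrite /K /= rmorphM hb mulr0.
have [K0 a b ab|KT] := simT K K2.
  apply/eqP; rewrite -subr_eq0; apply/eqP.
  suff : K (a - b) by rewrite K0.
  by rewrite /K /= rmorphB ab subrr.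
have : K 1 by rewrite KT.
by rewrite /K /= rmorph1 => /eqP; rewrite (negbTE T'1).
Qed.

(** Left multiplication by [y0] identifies [T] with the direct summand [y0 T],
    which is proper because its complement contains [(1 - y0 x0) y1], nonzero.
    An idempotent [a l] with [l a = 1] generates a copy of [T], and so it
    inherits this decomposition. *)
Lemma unit_factor_purely_infinite (x0 x1 y0 y1 : T) :
    (1 : T) != 0 -> (forall z : T, z != 0 -> exists a b, a * z * b = 1) ->
    x0 * y0 = 1 -> x1 * y1 = 1 -> x1 * y0 = 0 ->
  purely_infinite T.
Proof.
move=> T1 fact x0y0 x1y1 x1y0 J [J0 JD JM] JN0.
have [z Jz z0] : exists2 z, J z & z != 0.
  have [Jz|/existsNP[z /not_implyP[Jz /eqP z0]]] :=
    pselect (forall z, J z -> z = 0); last by exists z.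
  by case: JN0; apply/seteqP; split=> [z /Jz//|_ ->].
have [l [b lzb]] := fact z z0.
have [a [Ja la]] : exists a, J a /\ l * a = 1.
  by exists (z * b); split; [exact: JM | rewrite mulrA].
have laK c : l * (a * c) = c by rewrite mulrA la mul1r.
have xyK c : x0 * (y0 * c) = c by rewrite mulrA x0y0 mul1r.
exists (a * l); split; first exact: JM.
split; first by rewrite /Defs.idempotent -!mulrA laK.
have [f [fE ff yxf fyx]] : exists f, [/\ f = 1 - y0 * x0, forall c, f * (f * c) = f * c,
    forall c, y0 * (x0 * (f * c)) = 0 & forall c, f * (y0 * (x0 * c)) = 0].
  have fc c : (1 - y0 * x0) * c = c - y0 * (x0 * c) by rewrite mulrBl mul1r mulrA.
  have xf c : x0 * (c - y0 * (x0 * c)) = 0 by rewrite mulrBr xyK subrr.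
  exists (1 - y0 * x0); split=> // c; rewrite !fc.
  - by rewrite xf mulr0 subr0.
  - by rewrite xf mulr0.
  - by rewrite xyK subrr.
exists (a * y0 * x0 * l), (a * f * l); split.
- by split; rewrite /Defs.idempotent -!mulrA laK ?xyK ?ff.
- by split; rewrite -!mulrA laK ?yxf ?fyx mulr0.
- by rewrite fE mulrBr mulrBl mulr1 !mulrA addrC subrK.
- move=> h0; suff: (1 : T) = 0 by move/eqP: T1.
  have : x1 * (l * (a * f * l) * a) * y1 = 1.
    rewrite -!mulrA (mulrA l a y1) la mul1r laK fE mulrBl mul1r mulrBr.
    by rewrite -mulrA x1y1 !mulrA x1y0 !mul0r subr0.
  by rewrite h0 !(mulr0, mul0r) => <-.
exists (fun v => a * y0 * l * v); split; last 2 first.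
- by move=> u v _ _; rewrite mulrDr.
- by move=> u v _; rewrite mulrA.
split.
- move=> _ [c _ <-]; exists (a * y0 * l * c) => //.
  by rewrite -!mulrA !laK xyK.
- move=> u v; rewrite !inE => -[c _ <-] [d _ <-].
  rewrite -!mulrA !laK => /(congr1 (fun t => x0 * (l * t))).
  by rewrite !laK !xyK => ->.
- move=> _ [c _ <-]; exists (a * (l * (a * (x0 * (l * c))))).
    by exists (a * (x0 * (l * c))) => //; rewrite -!mulrA.
  by rewrite -!mulrA !laK.
Qed.

(** The error [z - z b z] has the form [z s] as well as [s' z], so a quasi-inverse
    of the error can be used to correct [b]. *)
Lemma regular_extension (J : T -> Prop) :
    (forall z, exists b, J (z - z * b * z)) ->
    (forall z, J z -> exists b, z * b * z = z) ->
  regular_ring T.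
Proof.
move=> quotJ regJ z; have [b /regJ] := quotJ z.
set c := z - _ => -[d cdc]; exists (b + (1 - b * z) * d * (1 - z * b)).
have zb : z * (1 - b * z) = c by rewrite mulrBr mulr1 mulrA.
have bz : (1 - z * b) * z = c by rewrite mulrBl mul1r.
rewrite mulrDr mulrDl !mulrA zb -(mulrA (c * d)) bz cdc.
by rewrite /c addrC subrK.
Qed.

(** Two isometries with orthogonal ranges provide arbitrarily many. *)
Lemma orthogonal_isometries (x0 x1 y0 y1 : T) :
    x0 * y0 = 1 -> x1 * y1 = 1 -> x1 * y0 = 0 -> x0 * y1 = 0 ->
  forall i j, x1 * x0 ^+ i * (y0 ^+ j * y1) = (i == j)%:R.
Proof.
move=> x0y0 x1y1 x1y0 x0y1; elim=> [|i IH] [|j].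
- by rewrite !expr0 mulr1 mul1r.
- by rewrite expr0 mulr1 exprS !mulrA x1y0 !mul0r.
- by rewrite expr0 mul1r exprSr -!mulrA x0y1 !mulr0.
by rewrite exprSr exprS -IH !mulrA -(mulrA (x1 * _)) x0y0 mulr1.
Qed.

(** A finitely generated projective module embeds in a free module [T^m], hence
    in [T] through a row of isometries with orthogonal ranges.  Its image there
    is a principal right ideal [z T], and a diagonalization of [z] yields a basis
    of [z T]. *)
Lemma diagonalizable_projective_free (x0 x1 y0 y1 : T) :
    (1 : T) != 0 ->
    x0 * y0 = 1 -> x1 * y1 = 1 -> x1 * y0 = 0 -> x0 * y1 = 0 ->
    (forall z : T, diagonalizable 1 z) ->
  fg_projective_right_modules_free T.
Proof.
move=> T1 x0y0 x1y1 x1y0 x0y1 diag M [m [g gen]] proj.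
pose lin (v : 'rV[T^c]_m) : M := \sum_(i < m) v ord0 i *: g i.
have lin_linear : linear lin.
  move=> c u v; rewrite /lin scaler_sumr -big_split /=.
  by apply: eq_bigr => i _; rewrite !mxE scalerDl scalerA.
pose linL := GRing.isLinear.Build _ _ _ _ lin lin_linear.
pose pL : {linear 'rV[T^c]_m -> M} := HB.pack lin linL.
have [|s sK] := proj _ _ pL (idfun : {linear M -> M}).
  move=> v; have [c ->] := gen v; exists (\row_i c i).
  by rewrite /= /lin; apply: eq_bigr => i _; rewrite mxE.
have {}sK v : v = \sum_(i < m) s v ord0 i *: g i by rewrite -[LHS]sK.
pose u (j : 'I_m) := y0 ^+ j * y1; pose p (i : 'I_m) := x1 * x0 ^+ i.
have pu i j : p i * u j = (i == j)%:R by exact: orthogonal_isometries.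
pose sigma (v : M) : T := \sum_(i < m) u i * (s v ord0 i : T).
have sigmaD v w : sigma (v + w) = sigma v + sigma w.
  by rewrite -big_split; apply: eq_bigr => i _; rewrite linearD mxE mulrDr.
have sigmaZ (c : T^c) v : sigma (c *: v) = sigma v * (c : T).
  by rewrite mulr_suml; apply: eq_bigr => i _; rewrite linearZ mxE -mulrA.
have sigma0 : sigma 0 = 0.
  by rewrite /sigma big1// => i _; rewrite linear0 mxE mulr0.
have sigma_sum (I : Type) (r : seq I) (F : I -> M) :
    sigma (\sum_(i <- r) F i) = \sum_(i <- r) sigma (F i).
  exact: (big_morph sigma sigmaD sigma0).
have psigma i v : p i * sigma v = s v ord0 i.
  rewrite mulr_sumr (bigD1 i)//= mulrA pu eqxx mul1r big1 ?addr0// => j ji.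
  by rewrite mulrA pu eq_sym (negbTE ji) mul0r.
have sigma_inj : injective sigma.
  move=> v w vw; rewrite (sK v) (sK w).
  by apply: eq_bigr => i _; rewrite -!psigma vw.
(* The idempotent which projects [T] onto the image of [sigma]. *)
pose z := \sum_(i < m) sigma (g i) * p i.
have zsigma v : z * sigma v = sigma v.
  rewrite mulr_suml [v in RHS]sK sigma_sum.
  by apply: eq_bigr => i _; rewrite sigmaZ -mulrA psigma.
have [r [a [l [lza zE]]]] := diag z.
pose t j : M := \sum_(i < m) (p i * a j : T^c) *: g i.
have sigmat j : sigma (t j) = z * a j.
  by rewrite sigma_sum mulr_suml; apply: eq_bigr => i _; rewrite sigmaZ mulrA.
have lsigmat i j : l i * sigma (t j) = (i == j)%:R.
  by rewrite sigmat mulrA lza mulr1.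
have t_inj : injective t.
  move=> i j /(congr1 (fun v => l i * sigma v)); rewrite !lsigmat eqxx.
  by case: eqP => // _ /eqP; rewrite (negbTE T1).
exists (fun b => exists j, b = t j); split=> [v|s' c us sB s0 b bs].
  pose c (b : M) : T := oapp (fun j => l j * sigma v) 0 [pick j | t j == b].
  have ct j : c (t j) = l j * sigma v.
    by rewrite /c; case: pickP => [i /eqP/t_inj ->|/(_ j)]//; rewrite eqxx.
  exists [seq t j | j <- enum 'I_r], c; split=> [b /mapP[j _ ->]|]; first by exists j.
  apply: sigma_inj; rewrite big_map big_enum sigma_sum -zsigma {1}zE mulr_suml.
  apply: eq_bigr => j _; rewrite sigmaZ sigmat ct -[RHS]mulrA -(mulrA _ z).
  by rewrite zsigma -!mulrA.
have [j bj] := sB b bs.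
move/(congr1 (fun v => l j * sigma v)): s0.
rewrite sigma_sum mulr_sumr sigma0 mulr0 (bigD1_seq b)//= big_seq_cond big1.
  by rewrite addr0 sigmaZ mulrA bj lsigmat eqxx mul1r.
move=> b' /andP[/sB[i ->]]; rewrite bj (inj_eq t_inj) eq_sym => /negbTE ji.
by rewrite sigmaZ mulrA lsigmat ji mul0r.
Qed.

End Consequences.

(** * Subrings of the ring of noncommutative power series *)

Section Series.
Context {k : fieldType} {X : finType} {R : subalgClosed (ncseries k X)}.
Hypotheses (hX : contains_free_algebra R) (hd : delta_invariant R).
Local Notation A := (subalg R).
Local Notation tau := (@sub_tau k X R).
Local Notation delta := (sub_delta hd).
Local Notation x := (sub_var hX).
Implicit Types (r s : A) (w v : seq X).

Definition aug r : k := val r [::].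

(** The letters of [v] are stripped from the right end of the words of [r] in the
    order in which the [y_i] of a product [r y_v] meet [r].  Therefore [coef v r]
    is the coefficient of the reversed word [rev v]. *)
Definition deltas v r : A := foldl (fun s i => delta i s) r v.
Definition coef v r : k := aug (deltas v r).

Lemma tauE r : tau r = (aug r)%:A.
Proof. exact: val_inj. Qed.

Lemma aug_is_zmod_morphism : zmod_morphism aug.
Proof. by []. Qed.

Lemma aug_is_monoid_morphism : monoid_morphism aug.
Proof.
split=> // r s; rewrite /aug rmorphM.
transitivity (\sum_(i < 1) val r (take i [::]) * val s (drop i [::])) => //.
by rewrite big_ord1.
Qed.

HB.instance Definition _ := GRing.isZmodMorphism.Build A k aug aug_is_zmod_morphism.
HB.instance Definition _ := GRing.isMonoidMorphism.Build A k aug aug_is_monoid_morphism.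

Lemma augM r s : aug (r * s) = aug r * aug s.
Proof. exact: rmorphM. Qed.

Lemma augZ (c : k) : aug c%:A = c.
Proof. by transitivity (c * 1) => //; rewrite mulr1. Qed.

Lemma aug_var i : aug (x i) = 0.
Proof. by []. Qed.

Lemma delta_var i j : delta j (x i) = (i == j)%:R.
Proof.
apply/val_inj/funext => w; rewrite /= /ncdelta /ncvar.
rewrite -[[:: i]]/(rcons [::] i) eqseq_rcons eq_sym [j == i]eq_sym andbC.
by case: eqVneq => // _; case: w.
Qed.

Lemma deltaM i r s : delta i (r * s) = delta i r * tau s + r * delta i s.
Proof. by apply: val_inj; rewrite /= ncdeltaM. Qed.

Lemma delta_is_zmod_morphism i : zmod_morphism (delta i).
Proof. by move=> r s; exact: val_inj. Qed.

HB.instance Definition _ i :=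
  GRing.isZmodMorphism.Build A A (delta i) (delta_is_zmod_morphism i).

Lemma deltas_cons i v r : deltas (i :: v) r = deltas v (delta i r).
Proof. by []. Qed.

Lemma deltas_is_zmod_morphism v : zmod_morphism (deltas v).
Proof. by elim: v => // i v IH r s; rewrite !deltas_cons raddfB IH. Qed.

HB.instance Definition _ v :=
  GRing.isZmodMorphism.Build A A (deltas v) (deltas_is_zmod_morphism v).

Lemma delta_scalar i (c : k) : delta i c%:A = 0.
Proof.
apply/val_inj/funext => w; transitivity (c * (nilp (rcons w i))%:R) => //.
by rewrite /nilp size_rcons mulr0.
Qed.

Lemma val_deltas v r w : val (deltas v r) w = val r (w ++ rev v).
Proof.
elim: v r => [|i v IH] r; first by rewrite cats0.
by rewrite deltas_cons IH rev_cons -rcons_cat.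
Qed.

Lemma coef_eq0 r : (forall v, coef v r = 0) -> r = 0.
Proof.
move=> r0; apply/val_inj/funext => w.
by rewrite -[RHS](r0 (rev w)) /coef /aug val_deltas revK.
Qed.

Lemma coef_neq0 r : r != 0 -> exists v, coef v r != 0.
Proof.
move=> r0; have [/coef_eq0 rE|/existsNP[v /eqP]] := pselect (forall v, coef v r = 0).
  by rewrite rE eqxx in r0.
by exists v.
Qed.

(** Both sides have the same constant term and the same image under each
    [delta i], because [delta i (s * x j)] is [s] or [0] according to whether
    [i = j].  This is what makes the commutation rule a consequence of
    invertibility of the column of variables. *)
Lemma var_decomposition r : r = (aug r)%:A + \sum_i delta i r * x i.
Proof.
apply/eqP; rewrite -subr_eq0; apply/eqP/coef_eq0 => v; rewrite /coef !raddfB.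
apply/eqP; rewrite subr_eq0; apply/eqP; case: v => [|i v].
  rewrite /= rmorphD /= augZ raddf_sum big1 ?addr0// => j _.
  by rewrite /= augM aug_var mulr0.
rewrite /= raddfD /= delta_scalar add0r raddf_sum; congr (aug (deltas _ _)).
rewrite (bigD1 i)//= deltaM delta_var eqxx mulr1 tauE aug_var scale0r mulr0 add0r.
rewrite big1 ?addr0// => j ji.
by rewrite deltaM delta_var (negbTE ji) mulr0 tauE aug_var scale0r mulr0 addr0.
Qed.

(** The series with zero constant term are not invertible, and they make up
    the kernel of a surjection onto the field [k]; locality of [A] then leaves no
    room for further non-invertible elements. *)
Lemma aug_unit (hloc : local_ring A) r : aug r != 0 -> is_unit r.
Proof.
have [[J0 JD JM] _] := hloc; move=> r0; apply/notP => rN.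
have : ~ is_unit (r - (aug r)%:A).
  case=> s [/(congr1 aug)]; rewrite rmorphM rmorphB /= augZ subrr mul0r rmorph1.
  by move/eqP; rewrite eq_sym oner_eq0.
move=> /(JM _ (- 1)); rewrite mulrN1 => /(JD _ _ rN); rewrite opprB addrC subrK.
apply; exists ((aug r)^-1)%:A.
by rewrite -!scalerAl !mul1r !scalerA mulfV// mulVf// scale1r.
Qed.
End Series.

(** * Rings with a skew commutation rule *)

Section Words.
Context {X : finType}.

Fixpoint words (m : nat) : seq (seq X) :=
  if m is m'.+1 then [seq i :: w | i <- index_enum X, w <- words m']
  else [:: [::]].

Fixpoint short_words (m : nat) : seq (seq X) :=
  if m is m'.+1 then [::] :: [seq i :: w | i <- index_enum X, w <- short_words m']
  else [::].

Lemma words_uniq m : uniq (words m).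
Proof.
elim: m => //= m IH; apply: allpairs_uniq => //; first exact: index_enum_uniq.
by move=> [i w] [j v] _ _ /= [-> ->].
Qed.

Lemma short_words_uniq m : uniq (short_words m).
Proof.
elim: m => //= m IH; rewrite allpairs_uniq ?index_enum_uniq//.
  by rewrite andbT; apply/negP => /allpairsP[[i w] []].
by move=> [i w] [j v] _ _ /= [-> ->].
Qed.

Lemma size_words m w : w \in words m -> size w = m.
Proof.
elim: m w => [|m IH] w; first by rewrite inE => /eqP ->.
by case/allpairsP => -[i v] [_ /IH <- ->].
Qed.

End Words.

Section Skew.
Context {k : fieldType} {X : finType} {R : subalgClosed (ncseries k X)}.
Hypotheses (hX : contains_free_algebra R) (hd : delta_invariant R).
Local Notation A := (subalg R).
Local Notation tau := (@sub_tau k X R).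
Local Notation delta := (sub_delta hd).
Local Notation x := (sub_var hX).
Context {T : pzRingType} (phi : {rmorphism A -> T}) (y : X -> T).
Hypothesis skew : forall i r, phi r * y i = y i * phi (tau r) + phi (delta i r).
Implicit Types (r s : A) (w v u : seq X).

Definition ywords w : T := word_prod y w.
(** The reversal makes [xwords w] a left inverse of [ywords w]. *)
Definition xwords w : T := word_prod (fun i => phi (x i)) (rev w).
Definition defect : T := 1 - \sum_i y i * phi (x i).
Local Notation yw := ywords.
Local Notation xw := xwords.
Local Notation e := defect.

Lemma ywords_cons i w : yw (i :: w) = y i * yw w.
Proof. by rewrite /yw /word_prod big_cons. Qed.

Lemma xwords_cat w v : xw (w ++ v) = xw v * xw w.
Proof. by rewrite /xw /word_prod rev_cat big_cat. Qed.

Lemma xwords_cons i w : xw (i :: w) = xw w * phi (x i).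
Proof. by rewrite -cat1s xwords_cat {2}/xw /word_prod big_seq1. Qed.

Lemma ywords0 : yw [::] = 1.
Proof. by rewrite /yw /word_prod big_nil. Qed.

Lemma xwords0 : xw [::] = 1.
Proof. by rewrite /xw /word_prod big_nil. Qed.

Lemma xwords_in w : exists r, xw w = phi r.
Proof.
exists (word_prod x (rev w)).
by rewrite /xw /word_prod rmorph_prod.
Qed.

Lemma var_mul_y i j : phi (x i) * y j = (i == j)%:R.
Proof. by rewrite skew tauE aug_var scale0r rmorph0 mulr0 add0r delta_var rmorph_nat. Qed.

Lemma xwords_ywords w v : size w = size v -> xw w * yw v = (w == v)%:R.
Proof.
elim: w v => [|i w IH] [|j v]//=; first by rewrite xwords0 ywords0 mulr1.
move=> [/IH wv]; rewrite xwords_cons ywords_cons -mulrA (mulrA (phi _)) var_mul_y.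
rewrite eqseq_cons; case: (i == j); first by rewrite mul1r.
by rewrite mul0r mulr0.
Qed.

Lemma defect_y i : e * y i = 0.
Proof.
rewrite mulrBl mul1r mulr_suml (bigD1 i)//= -mulrA var_mul_y eqxx mulr1.
rewrite big1 ?addr0 ?subrr// => j ji.
by rewrite -mulrA var_mul_y (negbTE ji) mulr0.
Qed.

Lemma var_defect i : phi (x i) * e = 0.
Proof.
rewrite mulrBr mulr1 mulr_sumr (bigD1 i)//= mulrA var_mul_y eqxx mul1r.
rewrite big1 ?addr0 ?subrr// => j ji.
by rewrite mulrA var_mul_y eq_sym (negbTE ji) mul0r.
Qed.

Lemma defect_idem : e * e = e.
Proof.
rewrite {2}/defect mulrBr mulr1 mulr_sumr big1 ?subr0// => i _.
by rewrite mulrA defect_y mul0r.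
Qed.

Lemma defect_xwords_ywords w v : e * xw w * yw v * e = (w == v)%:R * e.
Proof.
elim: w v => [|i w IH] [|j v].
- by rewrite xwords0 ywords0 !mulr1 defect_idem mul1r.
- by rewrite xwords0 ywords_cons mulr1 !mulrA defect_y !mul0r.
- by rewrite xwords_cons ywords0 mulr1 -!mulrA var_defect !mulr0 mul0r.
rewrite xwords_cons ywords_cons eqseq_cons !mulrA -(mulrA (e * xw w)) var_mul_y.
by case: (i == j); rewrite ?mulr1 ?IH// !(mulr0, mul0r).
Qed.

Lemma scalar_comm_y (c : k) i : phi c%:A * y i = y i * phi c%:A.
Proof. by rewrite skew delta_scalar rmorph0 addr0 tauE augZ. Qed.

Lemma scalar_comm_defect (c : k) : phi c%:A * e = e * phi c%:A.
Proof.
rewrite mulrBr mulrBl mulr1 mul1r mulr_sumr mulr_suml; congr (_ - _).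
apply: eq_bigr => i _; rewrite mulrA scalar_comm_y -!mulrA -!rmorphM.
by rewrite mulr_algl mulr_algr.
Qed.

(** All variables kill [e] from the left, so only the constant term survives. *)
Lemma mul_defect r : phi r * e = e * phi (aug r)%:A.
Proof.
rewrite {1}(var_decomposition hX hd r) rmorphD mulrDl scalar_comm_defect.
rewrite rmorph_sum mulr_suml big1 ?addr0// => i _.
by rewrite rmorphM -mulrA var_defect mulr0.
Qed.

Lemma defect_mul_ywords r v : e * phi r * yw v = e * phi (deltas hd v r).
Proof.
elim: v r => [|i v IH] r; first by rewrite ywords0 mulr1.
rewrite ywords_cons mulrA -(mulrA e) skew mulrDr mulrA defect_y mul0r add0r.
by rewrite IH.
Qed.

(** As long as the constant term vanishes, the commutation rule reads
    [r y_i = delta i r]. *)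
Lemma mul_ywords r v :
    (forall w, (size w < size v)%N -> coef hd w r = 0) ->
  phi r * yw v = phi (deltas hd v r).
Proof.
elim: v r => [|i v IH] r r0; first by rewrite ywords0 mulr1.
have r00 : aug r = 0 := r0 [::] isT.
rewrite ywords_cons mulrA skew tauE r00 scale0r rmorph0 mulr0 add0r IH// => w wv.
exact: (r0 (i :: w)).
Qed.

(** The identity obtained by substituting [1 = e + \sum_i y_i x_i] into itself
    [m] times. *)
Lemma resolution m :
  1 = \sum_(w <- short_words m) yw w * e * xw w + \sum_(w <- words m) yw w * xw w.
Proof.
elim: m => [|m IH]; first by rewrite big_nil add0r big_seq1 xwords0 ywords0 mulr1.
rewrite /= big_cons ywords0 xwords0 mul1r mulr1 !big_allpairs_dep -addrA -big_split /=.
rewrite (eq_bigr (fun i => y i * phi (x i))) ?subrK// => i _.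
rewrite -[y i in RHS]mulr1 [in RHS]IH mulrDr mulrDl !mulr_sumr !mulr_suml.
by congr (_ + _); apply: eq_bigr => w _; rewrite ywords_cons xwords_cons !mulrA.
Qed.

Definition span_words (z : T) : Prop :=
  exists s : seq (seq X * A), z = \sum_(p <- s) yw p.1 * phi p.2.

(** A word in the [x_i] at least as long as [w] absorbs [y_w] altogether. *)
Lemma span_xwords z : span_words z ->
  exists m, forall u, (m <= size u)%N -> exists r, xw u * z = phi r.
Proof.
move=> [s ->]; elim: s => [|[w r] s [m IH]].
  by exists 0%N => u _; exists 0; rewrite big_nil mulr0 rmorph0.
exists (maxn m (size w)) => u; rewrite geq_max => /andP[/IH[r' r'E] wu].
rewrite big_cons mulrDr r'E /= mulrA -(cat_take_drop (size w) u) xwords_cat.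
rewrite -(mulrA (xw _)) xwords_ywords ?size_takel//.
have [t ->] := xwords_in (drop (size w) u).
case: eqP => _; last by exists r'; rewrite mulr0 mul0r add0r.
by exists (t * r + r'); rewrite mulr1 rmorphD rmorphM.
Qed.

(** For an element [a e b] one letter more than what brings [a] into [A] is
    enough, since that letter removes the constant term seen by [e]. *)
Lemma ideal_xwords z : (forall t, span_words t) -> z \in ideal_gen e ->
  exists m, forall u, (m <= size u)%N -> xw u * z = 0.
Proof.
move=> sp /asboolP[s ->]; elim: s => [|[a b] s [m IH]].
  by exists 0%N => u _; rewrite big_nil mulr0.
have [m' am'] := span_xwords (sp a).
exists (maxn m m'.+1) => u; rewrite geq_max => /andP[/IH E mu].
rewrite big_cons mulrDr E addr0 /= !mulrA.
have [v [i [vm ->]]] : exists v i, (m' <= size v)%N /\ u = rcons v i.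
  by case/lastP: u mu {E} => // v i; rewrite size_rcons => mu; exists v, i.
have [r rE] := am' v vm.
rewrite -cats1 xwords_cat -(mulrA _ _ a) rE xwords_cons xwords0 mul1r -rmorphM.
by rewrite mul_defect augM aug_var mul0r scale0r rmorph0 mulr0 mul0r.
Qed.

Lemma defect_mul_span z : span_words z -> exists r, e * z = e * phi r.
Proof.
move=> [s ->]; exists (\sum_(p <- s | nilp p.1) p.2).
rewrite rmorph_sum !mulr_sumr [RHS]big_mkcond; apply: eq_bigr => -[[|i w] r] _ /=.
  by rewrite ywords0 mul1r.
by rewrite ywords_cons !mulrA defect_y !mul0r.
Qed.

(** The pivot comes from a word of least length occurring, reversed, in some entry
    of the column: right multiplication by this word in the [y_i] keeps all
    entries in [A], and it gives one of them a nonzero constant term. *)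
Lemma diagonalizable_span (hloc : local_ring A) z :
  e = 0 -> span_words z -> diagonalizable 1 z.
Proof.
move=> e0 /span_xwords[m xz].
have /choice[c cE] : forall w, exists r, (m <= size w)%N -> xw w * z = phi r.
  by move=> w; have [/xz[r rE]|] := leqP m (size w); [exists r | exists 0].
have -> : z = \sum_(w <- words m) yw w * 1 * phi (c w).
  rewrite -{1}[z]mul1r {1}(resolution m) e0 big1 => [|w _]; last by rewrite mulr0 mul0r.
  rewrite add0r mulr_suml [RHS]big_seq big_seq; apply: eq_bigr => w /size_words wm.
  by rewrite mulr1 -mulrA cE ?wm.
apply: (@diagonalizable_sum _ _ _ _ _ _ xw); rewrite ?mulr1 ?words_uniq//; last first.
  by move=> w v /size_words wm /size_words vm; rewrite !mulr1 xwords_ywords ?wm.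
move=> {c cE z xz}B c [i iB ci].
pose P l := `[< exists v j, [/\ size v = l, j \in B & coef hd v (c j) != 0] >].
have exP : exists l, P l.
  have [v vi] := coef_neq0 hd ci.
  by exists (size v); apply/asboolP; exists v, i.
have [l /asboolP[v [j [vl jB /(aug_unit hloc) vj]]] lmin] := ex_minnP exP.
have [t [vt _]] := vj.
exists j, (yw v * phi t), (fun i => deltas hd v (c i) * t); split=> // i' i'B.
rewrite !mul1r !mulr1 mulrA mul_ywords ?rmorphM// => w wv.
apply/eqP/negPn/negP => wi'.
suff : (l <= size w)%N by rewrite leqNgt -vl wv.
by apply: lmin; apply/asboolP; exists w, i'.
Qed.

(** Between two factors [e] the entries of the column become their coefficients,
    which lie in the field [k]: any nonzero coefficient is a pivot. *)
Lemma diagonalizable_ideal z :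
  (forall t, span_words t) -> z \in ideal_gen e -> diagonalizable e z.
Proof.
move=> sp /(ideal_xwords sp)[m xz].
have /choice[c cE] : forall w, exists r, e * (xw w * z) = e * phi r.
  by move=> w; exact: defect_mul_span.
have -> : z = \sum_(w <- short_words m) yw w * e * phi (c w).
  rewrite -{1}[z]mul1r (resolution m) mulrDl !mulr_suml.
  rewrite [X in _ + X]big_seq [X in _ + X]big1 ?addr0 => [|w /size_words wm].
    by apply: eq_bigr => w _; rewrite -!mulrA cE.
  by rewrite -mulrA xz ?wm// mulr0.
apply: (@diagonalizable_sum _ _ _ _ _ _ (fun w => e * xw w)).
- exact: defect_idem.
- move=> {c cE z xz}B c [i iB ci].
  have [v vi] := coef_neq0 hd ci.
  pose t : A := ((coef hd v (c i))^-1)%:A.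
  exists i, (yw v * phi t), (fun j => (aug (deltas hd v (c j) * t))%:A); split=> //.
    by rewrite augM augZ mulfV// scale1r.
  move=> j jB; rewrite !mulrA defect_mul_ywords -(mulrA e) -rmorphM.
  by rewrite -(mulrA e) mul_defect mulrA defect_idem.
- exact: short_words_uniq.
- by move=> w v _ _; exact: defect_xwords_ywords.
Qed.

(** Long powers of a variable kill each element of the ideal, but they have right
    inverses. *)
Lemma one_notin_ideal_defect :
  (forall t, span_words t) -> (1 : T) != 0 -> inhabited X -> 1 \notin ideal_gen e.
Proof.
move=> sp /eqP T1 [i]; apply/negP => /(ideal_xwords sp)[m x0]; apply: T1.
have xy : xw (nseq m i) * yw (nseq m i) = 1 by rewrite xwords_ywords ?eqxx.
by rewrite -xy -[xw _]mulr1 x0 ?size_nseq// mul0r.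
Qed.

(** Closure under products amounts to moving [A] to the right of the [y]-words by
    the commutation rule. *)
Lemma span_words_subring_closed : subring_closed (fun z : T => `[< span_words z >]).
Proof.
have sp0 : span_words 0 by exists [::]; rewrite big_nil.
have spD a b : span_words a -> span_words b -> span_words (a + b).
  by move=> [s ->] [t ->]; exists (s ++ t); rewrite big_cat.
have sp_sum (I : Type) (l : seq I) (F : I -> T) :
    (forall i, span_words (F i)) -> span_words (\sum_(i <- l) F i).
  by move=> spF; apply: big_ind => // i _.
have sp_mulr a r : span_words a -> span_words (a * phi r).
  move=> [s ->]; rewrite mulr_suml; apply: sp_sum => -[w t].
  by exists [:: (w, t * r)]; rewrite big_seq1 rmorphM mulrA.
have sp_mulyi i a : span_words a -> span_words (y i * a).
  move=> [s ->]; rewrite mulr_sumr; apply: sp_sum => -[w t].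
  by exists [:: (i :: w, t)]; rewrite big_seq1 ywords_cons mulrA.
have sp_muly w a : span_words a -> span_words (yw w * a).
  elim: w => [|i w IH] spa; first by rewrite ywords0 mul1r.
  by rewrite ywords_cons -mulrA; exact/sp_mulyi/IH.
have sp_phi r : span_words (phi r).
  by exists [:: ([::], r)]; rewrite big_seq1 ywords0 mul1r.
have sp_phiy r w : span_words (phi r * yw w).
  elim: w r => [|i w IH] r; first by rewrite ywords0 mulr1.
  rewrite ywords_cons mulrA skew mulrDl -mulrA; apply: spD; last exact: IH.
  exact/sp_mulyi/IH.
split; first by apply/asboolP; rewrite -(rmorph1 phi).
- move=> a b /asboolP spa /asboolP spb; apply/asboolP; apply: spD => //.
  by rewrite -mulrN1 -(rmorph1 phi) -rmorphN; exact: sp_mulr.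
move=> _ b /asboolP[s ->] /asboolP[t ->]; apply/asboolP.
rewrite mulr_suml; apply: (sp_sum) => -[w r]; rewrite mulr_sumr.
apply: sp_sum => -[v r'] /=; rewrite mulrA -(mulrA (yw w)).
exact/sp_mulr/sp_muly.
Qed.

(** Two distinct letters provide the two isometries with orthogonal ranges. *)
Lemma skew_purely_infinite (i j : X) :
    local_ring A -> e = 0 -> (forall z, span_words z) -> (1 : T) != 0 -> i != j ->
  [/\ purely_infinite T, simple_ring T, regular_ring T
    & fg_projective_right_modules_free T].
Proof.
move=> hloc e0 sp T1 ij.
have diag (z : T) : diagonalizable 1 z by exact: diagonalizable_span.
have fact (z : T) : z != 0 -> exists a b, a * z * b = 1.
  exact/diagonalizable1_unit.
split.
- apply: (@unit_factor_purely_infinite _ (phi (x i)) (phi (x j)) (y i) (y j)) => //;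
  by rewrite var_mul_y ?eqxx// eq_sym (negbTE ij).
- exact: unit_factor_simple.
- by move=> z; exact: diagonalizable_regular (diag z).
apply: (@diagonalizable_projective_free _ (phi (x i)) (phi (x j)) (y i) (y j)) => //;
  by rewrite var_mul_y ?eqxx// ?[j == i]eq_sym (negbTE ij).
Qed.

End Skew.

(** * Universal localization at the column of variables *)

(** The entries of the inverse row are the preimages of the unit vectors. *)
Lemma inverts_colP (A T : pzRingType) (m : nat) (x : 'I_m -> A)
    (psi : {rmorphism A -> T}) :
  inverts (\col_(i < m) x i) psi <->
  exists y : 'I_m -> T, (forall i j, psi (x i) * y j = (i == j)%:R) /\
    \sum_(j < m) y j * psi (x j) = 1.
Proof.
rewrite /inverts; set f := fun v : 'cV_1 => _.
have fE v i : f v i ord0 = psi (x i) * v ord0 ord0.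
  by rewrite !mxE big_ord1 !mxE.
split=> [[h fK hK]|[y [xy yx]]].
  pose y j := h (delta_mx j ord0) ord0 ord0.
  have xy i j : psi (x i) * y j = (i == j)%:R.
    by rewrite -fE hK mxE eqxx andbT.
  exists y; split=> //; set t := \sum_(j < m) _.
  suff /(congr1 h) : f (const_mx t) = f (const_mx 1).
    by rewrite !fK => /matrixP/(_ ord0 ord0); rewrite !mxE.
  apply/matrixP => i j; rewrite ord1 !fE !mxE mulr1 mulr_sumr (bigD1 i)//=.
  rewrite mulrA xy eqxx mul1r big1 ?addr0// => l li.
  by rewrite mulrA xy eq_sym (negbTE li) mul0r.
exists (fun w : 'cV_m => const_mx (\sum_(j < m) y j * w j ord0)) => v.
  apply/matrixP => i j; rewrite !ord1 !mxE -[RHS]mul1r -yx mulr_suml.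
  by apply: eq_bigr => l _; rewrite fE mulrA.
apply/matrixP => i j; rewrite !ord1 fE !mxE mulr_sumr (bigD1 i)//=.
rewrite mulrA xy eqxx mul1r big1 ?addr0// => l li.
by rewrite mulrA xy eq_sym (negbTE li) mul0r.
Qed.

Section Subring.
Context {L : pzRingType} (W : L -> bool) (Wring : subring_closed W).

Record subring := Subring { subring_val : L; subring_valP : W subring_val }.

HB.instance Definition _ := [isSub for subring_val].
HB.instance Definition _ := [Choice of subring by <:].
HB.instance Definition _ :=
  GRing.SubChoice_isSubPzRing.Build L W subring Wring.

Context {A : pzRingType} (phi : {rmorphism A -> L}) (phiW : forall r, W (phi r)).

Definition corestrict (r : A) : subring := Subring (phiW r).

Lemma corestrict_is_zmod_morphism : zmod_morphism corestrict.
Proof. by move=> r s; apply: val_inj; rewrite /= rmorphB. Qed.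

Lemma corestrict_is_monoid_morphism : monoid_morphism corestrict.
Proof.
by split=> [|r s]; apply: val_inj; rewrite /= ?rmorph1 ?rmorphM.
Qed.

HB.instance Definition _ :=
  GRing.isZmodMorphism.Build A subring corestrict corestrict_is_zmod_morphism.
HB.instance Definition _ :=
  GRing.isMonoidMorphism.Build A subring corestrict corestrict_is_monoid_morphism.

(** The universal property yields a retraction of [L] onto a subring over which
    the column is already invertible; composed with the inclusion it is the
    identity by uniqueness. *)
Lemma localization_generated (m : nat) (x y : 'I_m -> _) :
    is_universal_localization (\col_(i < m) x i) phi ->
    (forall i j, phi (x i) * y j = (i == j)%:R) ->
    \sum_(j < m) y j * phi (x j) = 1 ->
    (forall j, W (y j)) ->
  forall z, W z.
Proof.
move=> [inv univ] xy yx yW z.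
have : inverts (\col_(i < m) x i) corestrict.
  apply/inverts_colP; exists (fun j => Subring (yW j)); split=> [i j|].
    apply: val_inj; rewrite [LHS]xy.
    by case: (i == j).
  apply: val_inj; rewrite raddf_sum.
  exact: yx.
move=> /univ[[h hE] _].
have [_ uniq_h] := univ L phi inv.
have hK r : (val \o h) (phi r) = phi r by rewrite /= hE.
have /= <- := uniq_h (val \o h) idfun hK (fun=> erefl) z.
exact: valP.
Qed.

End Subring.

Section Localization.
Context {k : fieldType} {X : finType} {R : subalgClosed (ncseries k X)}.
Hypotheses (hX : contains_free_algebra R) (hd : delta_invariant R).
Local Notation A := (subalg R).

(** Expanding [r = tau r + \sum_j delta_j(r) x_j] shows that the inverse row of
    the variables obeys the skew commutation rule automatically. *)
Lemma inverse_row_skew (T : pzRingType) (phi : {rmorphism A -> T}) (y : X -> T) :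
    (forall i j, phi (sub_var hX i) * y j = (i == j)%:R) ->
    \sum_j y j * phi (sub_var hX j) = 1 ->
  forall i r, phi r * y i = y i * phi (sub_tau r) + phi (sub_delta hd i r).
Proof.
move=> xy yx i r.
have scalar_x (c : k) j : phi (sub_var hX j) * phi c%:A = phi c%:A * phi (sub_var hX j).
  by rewrite -!rmorphM mulr_algr mulr_algl.
have scalar_y (c : k) : phi c%:A * y i = y i * phi c%:A.
  rewrite -[LHS]mul1r -yx mulr_suml (bigD1 i)//= big1 => [|j ji].
    by rewrite addr0 -mulrA (mulrA (phi (sub_var _ _))) scalar_x -mulrA xy eqxx mulr1.
  by rewrite -mulrA (mulrA (phi (sub_var _ _))) scalar_x -mulrA xy (negbTE ji) !mulr0.
rewrite tauE -scalar_y {1}(var_decomposition hX hd r) rmorphD mulrDl; congr (_ + _).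
rewrite rmorph_sum mulr_suml (bigD1 i)//= rmorphM -mulrA xy eqxx mulr1.
rewrite big1 ?addr0// => j ji.
by rewrite rmorphM -mulrA xy (negbTE ji) mulr0.
Qed.

End Localization.

Theorem theorem5p4 (k : fieldType) (n : nat) (hn : (1 <= n)%N)
    (R : subalgClosed (ncseries k 'I_n.+1))
    (hloc : local_ring (subalg R))
    (hX : contains_free_algebra R)
    (hd : delta_invariant R)
    (S : pzRingType) (iota : {rmorphism subalg R -> S}) (y : 'I_n.+1 -> S)
    (hS : is_skew_extension (@sub_tau k 'I_n.+1 R) (sub_delta hd) iota y)
    (Rf : pzRingType) (phi : {rmorphism subalg R -> Rf})
    (hRf : is_universal_localization
             (\col_(i < n.+1) sub_var hX i : 'cV[subalg R]_n.+1) phi) :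
  let e : S := 1 - \sum_(i < n.+1) y i * iota (sub_var hX i) in
  [/\ [/\ purely_infinite Rf, simple_ring Rf & regular_ring Rf],
      fg_projective_right_modules_free Rf,
      (exists h : {rmorphism Rf -> quot_ring e},
         bijective h /\ forall r, h (phi r) = quot_pi e (iota r))
    & regular_ring S].
Proof.
have [iota_inj skewS spanS _] := hS.
set e := defect hX iota y => /=.
have n01 : ord0 != ord_max :> 'I_n.+1 by rewrite -val_eqE /= eq_sym -lt0n.
have spS z : span_words iota y z.
  have [s [c ->]] := spanS z; exists [seq (w, c w) | w <- s].
  by rewrite big_map.
have S1 : (1 : S) != 0.
  rewrite -(rmorph1 iota) -(rmorph0 iota) (inj_eq iota_inj).
  by apply/eqP => /(congr1 aug)/eqP; rewrite /aug /= oner_eq0.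
pose iotaQ : {rmorphism subalg R -> quot_ring e} := quot_pi e \o iota.
pose yQ i := quot_pi e (y i).
have skewQ i r : iotaQ r * yQ i = yQ i * iotaQ (sub_tau r) + iotaQ (sub_delta hd i r).
  by have := congr1 (quot_pi e) (skewS i r); rewrite rmorphD !rmorphM.
have Qsurj (z : quot_ring e) : exists t, z = quot_pi e t.
  by exists (repr z); rewrite /quot_pi reprK.
have spQ z : span_words iotaQ yQ z.
  have [t ->] := Qsurj z; have [s ->] := spS t; exists s.
  rewrite rmorph_sum; apply: eq_bigr => p _; rewrite rmorphM; congr (_ * _).
  by rewrite /ywords /word_prod rmorph_prod.
have e0 : defect hX iotaQ yQ = 0.
  have -> : defect hX iotaQ yQ = quot_pi e e.
    rewrite rmorphB rmorph1 rmorph_sum; congr (_ - _).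
    by apply: eq_bigr => i _; rewrite rmorphM.
  rewrite -(rmorph0 (quot_pi e)); apply/quot_pi_eq; rewrite subr0.
  by apply/asboolP; exists [:: (1, 1)]; rewrite big_seq1 mul1r mulr1.
have Q1 : (1 : quot_ring e) != 0.
  rewrite -(rmorph1 (quot_pi e)) -(rmorph0 (quot_pi e)).
  apply/eqP => /quot_pi_eq; rewrite subr0; apply/negP.
  exact: (one_notin_ideal_defect hX skewS spS S1 (inhabits ord0)).
have [_ _ regQ _] := skew_purely_infinite skewQ hloc e0 spQ Q1 n01.
have regS : regular_ring S.
  apply: (@regular_extension _ (fun z => z \in ideal_gen e)) => z.
    have [b] := regQ (quot_pi e z); have [t ->] := Qsurj b => bE.
    by exists t; apply/quot_pi_eq; rewrite !rmorphM bE.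
  move=> zI; apply: (@diagonalizable_regular _ e).
  exact: (diagonalizable_ideal skewS spS zI).
have [y' [xy' y'x]] : exists y' : 'I_n.+1 -> Rf,
    (forall i j, phi (sub_var hX i) * y' j = (i == j)%:R) /\
    \sum_j y' j * phi (sub_var hX j) = 1.
  by apply/inverts_colP; case: hRf.
have skewF := inverse_row_skew hd xy' y'x.
have spF z : span_words phi y' z.
  apply/asboolP.
  apply: (localization_generated (span_words_subring_closed skewF) _ hRf xy' y'x).
    by move=> r; apply/asboolP; exists [:: ([::], r)]; rewrite big_seq1 ywords0 mul1r.
  move=> j; apply/asboolP; exists [:: ([:: j], 1)].
  by rewrite big_seq1 ywords_cons ywords0 rmorph1 !mulr1.
have xyQ i j : iotaQ (sub_var hX i) * yQ j = (i == j)%:R.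
  exact: (var_mul_y hX skewQ).
have yxQ : \sum_j yQ j * iotaQ (sub_var hX j) = 1.
  by apply/eqP; rewrite -subr_eq0 -opprB oppr_eq0; apply/eqP.
have [h hE] : exists h : {rmorphism Rf -> quot_ring e}, forall r, h (phi r) = iotaQ r.
  have [_ univ] := hRf; apply: (univ _ iotaQ _).1.
  by apply/inverts_colP; exists yQ.
have F1 : (1 : Rf) != 0.
  by apply: contra Q1 => /eqP F0; rewrite -(rmorph1 h) F0 rmorph0.
have eF : defect hX phi y' = 0 by rewrite /defect y'x subrr.
have [piF simF regF freeF] := skew_purely_infinite skewF hloc eF spF F1 n01.
split=> //; exists h; split=> //.
have hy i : h (y' i) = yQ i.
  rewrite -[LHS]mul1r -yxQ mulr_suml (bigD1 i)//= big1 => [|j ji].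
    by rewrite addr0 -mulrA -[quot_pi e (iota _)]hE -rmorphM xy' eqxx rmorph1 mulr1.
  by rewrite -mulrA -[quot_pi e (iota _)]hE -rmorphM xy' (negbTE ji) rmorph0 mulr0.
have h_inj : injective h by exact: simple_ring_hom_injective.
have h_surj z : exists t, h t = z.
  have [s ->] := spQ z; exists (\sum_(p <- s) ywords y' p.1 * phi p.2).
  rewrite rmorph_sum; apply: eq_bigr => p _; rewrite rmorphM hE; congr (_ * _).
  by rewrite /ywords /word_prod rmorph_prod; apply: eq_bigr => i _.
have /choice[g gK] := h_surj.
by exists g => // z; apply: h_inj; rewrite gK.
Qed.
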